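(* For all integers $m,n,p\geq 3$, $$\mathrm{sc}_{\star\cdot(\star\cap\star)}(m,n,p)=(m-1)2^{np}+2^{np-1}$$ and $$\mathrm{sc}_{\star\cdot(\star\cup\star)}(m,n,p)=(m-1)(2^{n+p}-2^n-2^p+2)+2^{n+p-2}.$$ In both cases the bound is reached by the triple of languages over the three-letter alphabet $\{a,b,c\}$ recognized by the automata $$\left(\mathcal X_{m}(a,b,-;\{c\}),\ \mathcal X_{n}(b,a,c;\emptyset),\ \mathcal X_{p}(b,-,c;\{a\})\right);$$ that is, writing $L_1,L_2,L_3$ for these three languages, $\mathrm{sc}(L_1\cdot(L_2\cap L_3))$ and $\mathrm{sc}(L_1\cdot(L_2\cup L_3))$ equal the respective values above.
   Context: For a regular language $L$ over a finite alphabet $\Sigma$, $\mathrm{sc}(L)$ denotes the number of states of its minimal complete deterministic finite automaton (DFA) over $\Sigma$. For a ternary operation $\otimes$ on languages, $\mathrm{sc}_\otimes(m,n,p)=\max \mathrm{sc}(\otimes(L_1,L_2,L_3))$, the maximum being over all finite alphabets $\Sigma$ and all regular languages $L_1,L_2,L_3$ over the same alphabet $\Sigma$ with $\mathrm{sc}(L_1)=m$, $\mathrm{sc}(L_2)=n$, $\mathrm{sc}(L_3)=p$. The operation $\star\cdot(\star\circ\star)$ is $(L_1,L_2,L_3)\mapsto L_1\cdot(L_2\circ L_3)$, where $\cdot$ is catenation. $\mathcal X_n(\sigma_1,\sigma_2,\sigma_3;\Sigma\setminus\{\sigma_1,\sigma_2,\sigma_3\})$ is the complete DFA over $\Sigma$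 with state set $\{0,\dots,n-1\}$, initial state $0$, unique final state $n-1$, in which the letter $\sigma_1$ acts as the cycle $(0,1,\dots,n-1)$ (i.e. $q\mapsto q+1 \bmod n$), $\sigma_2$ acts as the transposition exchanging $0$ and $1$, $\sigma_3$ acts as the contraction sending $1$ to $0$ and fixing all other states, and all other letters act as the identity; a ''$-$'' in place of $\sigma_i$ means that no letter plays that role. *)

(* Defs.v *)
From HB Require Import structures.
From mathcomp Require Import all_boot all_fingroup.
From mathcomp Require Import classical_sets.

Set Implicit Arguments.
Unset Strict Implicit.
Unset Printing Implicit Defensive.

Local Open Scope classical_set_scope.

Definition language (A : finType) := set (seq A).

Definition catenation (A : finType) (L1 L2 : language A) : language A :=
  [set u ++ v | u in L1 & v in L2].

(* [dfa_step] is a total function, so these automata are complete; not every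
   state is required to be reachable. *)
Record dfa (A : finType) := Dfa {
  dfa_state :> finType;
  dfa_init : dfa_state;
  dfa_final : {set dfa_state};
  dfa_step : dfa_state -> A -> dfa_state }.

Definition dfa_lang (A : finType) (M : dfa A) : language A :=
  [set w | foldl (@dfa_step A M) (dfa_init M) w \in dfa_final M].

Definition minimal_dfa (A : finType) (L : language A) (M : dfa A) : Prop :=
  dfa_lang M = L /\
  forall N : dfa A, dfa_lang N = L -> #|dfa_state M| <= #|dfa_state N|.

(* "sc(L) = k" as a relation: a non-regular L is related to no k, and a regular
   one to exactly one. *)
Definition is_sc (A : finType) (L : language A) (k : nat) : Prop :=
  exists2 M : dfa A, minimal_dfa L M & #|dfa_state M| = k.

Definition ternary_op :=
  forall A : finType, language A -> language A -> language A -> language A.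

(* "sc_op(m, n, p) = v": over all triples with the prescribed state
   complexities, sc of the result is always defined and at most v, and v is
   attained. *)
Definition is_sc_op (op : ternary_op) (m n p v : nat) : Prop :=
  (forall (A : finType) (L1 L2 L3 : language A),
     is_sc L1 m -> is_sc L2 n -> is_sc L3 p ->
     exists2 k, is_sc (op A L1 L2 L3) k & k <= v) /\
  (exists (A : finType) (L1 L2 L3 : language A),
     [/\ is_sc L1 m, is_sc L2 n, is_sc L3 p & is_sc (op A L1 L2 L3) v]).

Definition cat_cap : ternary_op :=
  fun A L1 L2 L3 => catenation L1 (L2 `&` L3).

Definition cat_cup : ternary_op :=
  fun A L1 L2 L3 => catenation L1 (L2 `|` L3).

(* Letter action in X_n(s1, s2, s3; ...).  [None] stands for a "-"; the letters
   of A playing none of the three roles, listed after the semicolon in the usual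
   notation, act as the identity.  The given letters are meant to be distinct.
   For 0 < n, the state type 'I_n.-1.+1 is {0, ..., n-1}. *)
Definition X_step (A : finType) (n : nat) (s1 s2 s3 : option A)
    (q : 'I_n.-1.+1) (x : A) : 'I_n.-1.+1 :=
  if Some x == s1 then ordS q
  else if Some x == s2 then tperm (inord 0) (inord 1) q
  else if Some x == s3 then (if q == inord 1 then inord 0 else q)
  else q.

Definition X_dfa (A : finType) (n : nat) (s1 s2 s3 : option A) : dfa A :=
  @Dfa A 'I_n.-1.+1 ord0 [set ord_max]%SET (@X_step A n s1 s2 s3).

Inductive letter := La | Lb | Lc.

Definition ord_of_letter (x : letter) : 'I_3 :=
  match x with
  | La => @Ordinal 3 0 isT | Lb => @Ordinal 3 1 isT | Lc => @Ordinal 3 2 isT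
  end.

Definition letter_of_ord (i : 'I_3) : letter :=
  match val i with 0 => La | 1 => Lb | _ => Lc end.

Lemma ord_of_letterK : cancel ord_of_letter letter_of_ord.
Proof. by case. Qed.

HB.instance Definition _ := Finite.copy letter (can_type ord_of_letterK).

Definition witness1 (m : nat) : language letter :=
  dfa_lang (X_dfa m (Some La) (Some Lb) None).
Definition witness2 (n : nat) : language letter :=
  dfa_lang (X_dfa n (Some Lb) (Some La) (Some Lc)).
Definition witness3 (p : nat) : language letter :=
  dfa_lang (X_dfa p (Some Lb) None (Some Lc)).

(* Main.v *)
Require Import Defs.
From mathcomp Require Import boolp classical_sets.
From mathcomp Require Import all_boot.
From mathcomp Require Import perm zify.

(** The subset construction for [L1 . L] has states [(q, S)], where [q] is a
    state of the first automaton and [S] is a set of states of an automaton for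
    [L]: the product automaton for [L2 `&` L3], the disjoint union of the two
    automata for [L2 `|` L3].  When [q] is final, [S] contains the initial states
    [I]; for the union, [S] moreover meets either both summands or none.  Counting
    these pairs gives the upper bounds.

    For the witnesses, a pair [(x, y)] of states of the last two automata is
    followed as a token.  The letters [a] and [b] act on tokens through the
    transitive group [S_n * C_p], and they permute the states [q].

    Reachability is by induction on the size of [S]: a set containing the token
    (0, 0) is obtained at [q = m - 1] from a smaller one, and the token can then
    be moved anywhere while [q] alternates between 0 and 1.

    For [S != S'], a token in [S] and not in [S'] is moved to the accepting
    position so that [q'] never passes through [m - 1] when the insertion of [I]
    could touch the token.  For [q != q'], first bring [q] to [m - 1] by a power
    of [a]; then a long power of [cb] collapses everything to the states 1, apart
    from the states [I] which are present for [q] only. *)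

Set Implicit Arguments.
Unset Strict Implicit.
Unset Printing Implicit Defensive.

(** * Preliminaries on finite sets *)

(** On a finite type the inverse of an injection is pointwise an iterate of it, so a property that
    is preserved by [f] is reflected by it too. This makes every permutation move below usable in
    both directions. *)
Lemma inj_closed (T : finType) (f : T -> T) (P : T -> Prop) :
  injective f -> (forall x, P x -> P (f x)) -> forall x, P (f x) -> P x.
Proof.
move=> fI Pf x Pfx; rewrite -(finv_f fI x) /finv.
by elim: (_.-1) => //= k; apply: Pf.
Qed.

Lemma card_supersets (T : finType) (I : {set T}) :
  #|[set S : {set T} | I \subset S]| = 2 ^ (#|T| - #|I|).
Proof.
have -> : [set S : {set T} | I \subset S] = @setC T @^-1: powerset (~: I).
  by apply/setP => S; rewrite !inE setCS.
have -> : #|T| - #|I| = #|~: I| by rewrite -(cardsC I) addKn.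
rewrite -card_powerset; apply: on_card_preimset.
by apply: onW_bij; exact: (inv_bij (@setCK T)).
Qed.

Lemma imset_preimset_inj (T : finType) (f : T -> T) (S : {set T}) :
  injective f -> f @: (f @^-1: S) = S.
Proof.
move=> fI; apply/setP=> y; rewrite -(f_finv fI y) mem_imset // inE.
by rewrite f_finv.
Qed.

Lemma card_preimset_inj (T : finType) (f : T -> T) (S : {set T}) :
  injective f -> #|f @^-1: S| = #|S|.
Proof. by move=> fI; rewrite -{2}(imset_preimset_inj S fI) card_imset. Qed.

(** * Reachability, distinguishability and state complexity *)

Section Dfa.
Variable A : finType.
Implicit Types (M N : dfa A) (L : language A).

Definition run M := foldl (@dfa_step A M).

Definition reachable M (q : M) := exists w, run (dfa_init M) w = q.

Definition distinguishable M (q r : M) :=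
  exists w, (run q w \in dfa_final M) != (run r w \in dfa_final M).

Lemma reachable_step M (q : M) x : reachable q -> reachable (dfa_step q x).
Proof. by case=> w <-; exists (rcons w x); rewrite /run foldl_rcons. Qed.

Lemma distinguishable_run M (q r : M) w :
  distinguishable (run q w) (run r w) -> distinguishable q r.
Proof. by case=> v; rewrite /run -!foldl_cat => h; exists (w ++ v). Qed.

Lemma distinguishable_sym M (q r : M) :
  distinguishable q r -> distinguishable r q.
Proof. by case=> w h; exists w; rewrite eq_sym. Qed.

Lemma sub_dfaP M (R : {set M}) :
  dfa_init M \in R -> (forall q x, q \in R -> dfa_step q x \in R) ->
  exists2 N, dfa_lang N = dfa_lang M & #|N| = #|R|.
Proof.
move=> R0 RS; pose T := {q : M | q \in R}.
pose s0 : T := exist (fun q => q \in R) _ R0.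
pose st (s : T) x : T :=
  exist (fun q => q \in R) (dfa_step (val s) x) (RS _ x (valP s)).
exists (Dfa s0 [set s | val s \in dfa_final M] st); last first.
  exact: card_sig.
apply/seteqP; split => w; rewrite /dfa_lang /= inE.
all: have -> // : val (foldl st s0 w) = run (dfa_init M) w.
all: by rewrite /run; elim/last_ind: w => //= w x; rewrite !foldl_rcons /= => ->.
Qed.

Lemma sc_le M : exists2 k, is_sc (dfa_lang M) k & k <= #|M|.
Proof.
have [N [eN minN]] : exists N, minimal_dfa (dfa_lang M) N.
  have ex : exists k, `[< exists2 N, dfa_lang N = dfa_lang M & #|N| = k >].
    by exists #|M|; apply/asboolP; exists M.
  case: (ex_minnP ex) => k /asboolP[N eN <-] minN; exists N; split=> // N' eN'.
  by apply: minN; apply/asboolP; exists N'.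
by exists #|N|; [exists N | exact: minN].
Qed.

Lemma sc_invariant_le M (R : {set M}) :
  dfa_init M \in R -> (forall q x, q \in R -> dfa_step q x \in R) ->
  exists2 k, is_sc (dfa_lang M) k & k <= #|R|.
Proof.
by move=> R0 RS; have [N <- <-] := sub_dfaP R0 RS; apply: sc_le.
Qed.

(** For the lower bound, send each [q] in [R] to the state where a rival automaton stands after a
    fixed word leading to [q]. A word that distinguishes two states of [R] also separates their
    images, so this map is injective. *)
Lemma sc_invariant_eq M (R : {set M}) :
  dfa_init M \in R -> (forall q x, q \in R -> dfa_step q x \in R) ->
  {in R, forall q, reachable q} ->
  {in R &, forall q r, q != r -> distinguishable q r} ->
  is_sc (dfa_lang M) #|R|.
Proof.
move=> R0 RS Rreach Rdist; have [N eN cN] := sub_dfaP R0 RS.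
exists N => //; split=> // N' eN'; rewrite cN.
have wit q : {w | q \in R -> run (dfa_init M) w = q}.
  apply: cid; case: (boolP (q \in R)) => [/Rreach[w <-]|_]; first by exists w.
  by exists [::].
pose f q := run (dfa_init N') (sval (wit q)).
rewrite -(@card_in_imset _ _ f R) ?max_card // => q r qR rR fqr.
apply/eqP; apply: contraT => /(Rdist _ _ qR rR)[w].
rewrite -{1}(svalP (wit q) qR) -{1}(svalP (wit r) rR) /run -!foldl_cat.
have acc v : (run (dfa_init M) v \in dfa_final M)
           = (run (dfa_init N') v \in dfa_final N').
  have := congr1 (fun L : language A => L v) eN'.
  by rewrite /dfa_lang /= => e; apply/idP/idP; rewrite /run e.
by rewrite !acc /run !foldl_cat; move: fqr; rewrite /f /run => ->; rewrite eqxx.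
Qed.

End Dfa.

(* [K] is the disjoint union or the product of the state sets of automata for
   the last two languages; [I] and [F] are its initial and final states.  One
   subset construction then covers both [L2 `|` L3] and [L2 `&` L3]. *)
Section CatDfa.
Variables (A : finType) (M1 : dfa A) (K : finType) (kstep : K -> A -> K).
Variables (I F : {set K}).

Definition cat_enter (q : M1) (S : {set K}) :=
  if q \in dfa_final M1 then S :|: I else S.

Definition cat_step (s : M1 * {set K}) (x : A) : M1 * {set K} :=
  (dfa_step s.1 x, cat_enter (dfa_step s.1 x) (kstep^~ x @: s.2)).

Definition cat_dfa : dfa A :=
  Dfa (dfa_init M1, cat_enter (dfa_init M1) set0)
      [set s : M1 * {set K} | s.2 :&: F != set0] cat_step.

Lemma run_cat_fst (s : M1 * {set K}) w : (foldl cat_step s w).1 = run s.1 w.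
Proof. by elim: w s => //= x w IH s; rewrite IH. Qed.

Lemma mem_run_cat (s : M1 * {set K}) w k :
  k \in s.2 -> foldl kstep k w \in (foldl cat_step s w).2.
Proof.
elim: w s k => //= x w IH s k ks; apply: IH; rewrite /cat_step /cat_enter /=.
by case: ifP => _; rewrite ?inE imset_f.
Qed.

Lemma run_cat_sndP w k :
  reflect (exists u v, [/\ w = u ++ v, dfa_lang M1 u
             & exists2 i, i \in I & foldl kstep i v = k])
          (k \in (foldl cat_step (dfa_init cat_dfa) w).2).
Proof.
apply: (iffP idP).
  elim/last_ind: w k => [|w x IH] k.
    rewrite /= /cat_enter; case: ifP => [F0|]; rewrite !inE // => kI.
    by exists [::], [::]; split=> //; exists k.
  have old k' : k' \in kstep^~ x @: (foldl cat_step (dfa_init cat_dfa) w).2 ->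
     exists u v, [/\ rcons w x = u ++ v, dfa_lang M1 u
             & exists2 i, i \in I & foldl kstep i v = k'].
    case/imsetP=> k0 /IH[u [v [-> uL [i iI <-]]]] ->.
    exists u, (rcons v x); rewrite rcons_cat; split=> //.
    by exists i; rewrite // foldl_rcons.
  rewrite foldl_rcons /cat_step /= /cat_enter; case: ifP => [Fq|_]; last exact: old.
  rewrite inE => /orP[|kI]; first exact: old.
  exists (rcons w x), [::]; rewrite cats0; split=> //; last by exists k.
  by rewrite /dfa_lang /= foldl_rcons; move: Fq; rewrite run_cat_fst.
case=> u [v [-> uL [i iI <-]]]; rewrite foldl_cat; apply: mem_run_cat.
case/lastP: u uL => [|u x] uL /=; rewrite ?foldl_rcons /= /cat_enter.
  by rewrite ifT // !inE iI orbT.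
by rewrite run_cat_fst -[dfa_step _ _](foldl_rcons _ _ u x) ifT // inE iI orbT.
Qed.

Lemma cat_dfa_lang (L : language A) :
  (forall v, L v <-> exists2 i, i \in I & foldl kstep i v \in F) ->
  dfa_lang cat_dfa = catenation (dfa_lang M1) L.
Proof.
move=> LE; apply/seteqP; split=> w.
  rewrite {1}/dfa_lang /= inE => /set0Pn[k /setIP[/run_cat_sndP]].
  by case=> u [v [-> uL [i iI <-]]] iF; exists u => //; exists v => //; apply/LE; exists i.
case=> u uL [v /LE[i iI iF] <-]; rewrite /dfa_lang /= inE; apply/set0Pn.
exists (foldl kstep i v); rewrite inE iF andbT.
by apply/run_cat_sndP; exists u, v; split=> //; exists i.
Qed.

(** [B] is the family of sets that can occur as second component: all sets for the intersection,
    [cup_sets] for the union. *)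
Definition cat_inv (B : {set {set K}}) : {set cat_dfa} :=
  [set s : M1 * {set K} | (s.2 \in B) && ((s.1 \in dfa_final M1) ==> (I \subset s.2))].

Lemma card_cat_inv B :
  #|cat_inv B| = (#|M1| - #|dfa_final M1|) * #|B|
               + #|dfa_final M1| * #|[set S in B | I \subset S]|.
Proof.
have -> : cat_inv B = setX (~: dfa_final M1) B
            :|: setX (dfa_final M1) [set S in B | I \subset S].
  by apply/setP => -[q S]; rewrite !inE /=; case: (q \in _); rewrite ?orbF /= ?andbT.
rewrite cardsU disjoint_setI0 ?cards0 ?subn0; last first.
  by apply/pred0Pn => -[[q S]]; rewrite /= !inE; case: (q \in _); rewrite ?andbF.
by rewrite !cardsX; congr (_ * _ + _); rewrite -(cardsC (dfa_final M1)) addKn.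
Qed.

Section Invariant.
Variable B : {set {set K}}.
Hypotheses (B0 : set0 \in B)
  (Bstep : forall S x, S \in B -> kstep^~ x @: S \in B)
  (BI : forall S, S \in B -> S :|: I \in B).

Lemma cat_enter_inv q S : S \in B -> (q, cat_enter q S) \in cat_inv B.
Proof.
move=> SB; rewrite inE /cat_enter /=; case: (q \in _) => /=; last by rewrite SB.
by rewrite BI //= subsetUr.
Qed.

Lemma cat_init_inv : dfa_init cat_dfa \in cat_inv B.
Proof. exact: cat_enter_inv. Qed.

Lemma cat_step_inv s x : s \in cat_inv B -> dfa_step s x \in cat_inv B.
Proof. by rewrite inE => /andP[sB _]; apply: cat_enter_inv; apply: Bstep. Qed.

Lemma cat_sc_le : dfa_final M1 != set0 ->
  exists2 k, is_sc (dfa_lang cat_dfa) k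
    & k <= (#|M1| - 1) * #|B| + #|[set S in B | I \subset S]|.
Proof.
rewrite -card_gt0 => F0; have [k hk le_k] := sc_invariant_le cat_init_inv cat_step_inv.
(* With [f] final states the count is [(#|M1| - f) * #|B| + f * C], where [C] is the number of
   supersets of [I] in [B]. As [C <= #|B|], the value at [f = 1] is the largest. *)
exists k => //; apply: leq_trans le_k _; rewrite card_cat_inv.
have le_C : #|[set S in B | I \subset S]| <= #|B|.
  by apply: subset_leq_card; apply/subsetP=> S; rewrite inE => /andP[].
have le_F : #|dfa_final M1| <= #|M1| by apply: max_card.
by move: le_C le_F F0; case: #|dfa_final M1| => // f; nia.
Qed.

End Invariant.
End CatDfa.

(** * The cyclic shift and the transposition of 0 and 1 *)

Local Notation swap01 := (tperm (inord 0) (inord 1)).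

Lemma val_iter_ordS n (i : 'I_n) k : i + k < n -> val (iter k (@ordS n) i) = i + k.
Proof.
elim: k => [|k IH] lt_n; first by rewrite addn0.
have {}IH : iter k (@ordS n) i = i + k :> nat by apply: IH; lia.
by rewrite iterS /= IH -addnS modn_small.
Qed.

Lemma iter_ordS_from0 n (i : 'I_n.+1) : iter i (@ordS n.+1) (inord 0) = i.
Proof. by apply: val_inj; rewrite val_iter_ordS; rewrite /= inordK ?add0n. Qed.

Lemma ordS_neq_max n (q : 'I_n.+1) : q != ord_max -> ordS q = q.+1 :> nat.
Proof.
move=> qN; rewrite /= modn_small // ltnS ltn_neqAle -ltnS ltn_ord andbT.
by apply: contra qN => /eqP e; apply/eqP/val_inj.
Qed.

Lemma ordS_max n : ordS (@ord_max n) = inord 0.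
Proof. by apply: val_inj; rewrite /= modnn inordK. Qed.

Lemma iter_ordS_hits n (x y : 'I_n.+1) : exists k, iter k (@ordS n.+1) x = y.
Proof.
exists (y + (n - x).+1); rewrite iterD iterS.
have -> : iter (n - x) (@ordS n.+1) x = ord_max.
  by apply: val_inj; rewrite val_iter_ordS /=; have := ltn_ord x; lia.
by rewrite ordS_max iter_ordS_from0.
Qed.

Lemma ordS_inj n : injective (@ordS n).
Proof. exact: can_inj (@ordSK n). Qed.

Lemma ordS_inord n k : k.+1 < n.+1 -> ordS (inord k : 'I_n.+1) = inord k.+1.
Proof. by move=> lt_k; apply: val_inj; rewrite /= !inordK ?modn_small //; lia. Qed.

Lemma inord_eq n j k : j <= n -> k <= n -> ((inord j : 'I_n.+1) == inord k) = (j == k).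
Proof. by move=> lj lk; rewrite -val_eqE /= !inordK. Qed.

Lemma swap01_fix n (i : 'I_n.+2) : 1 < i -> swap01 i = i.
Proof. by move=> gt1; rewrite tpermD // -val_eqE /= inordK; lia. Qed.

(** With at least three states the last one is not moved by the transposition. Hence the letter [b]
    never changes whether [q] is final. *)
Lemma swap01_max n (q : 'I_n.+3) : (swap01 q == ord_max) = (q == ord_max).
Proof. by rewrite -{1}(@swap01_fix _ ord_max) // (inj_eq perm_inj). Qed.

Lemma max_neq_inord n k : k <= n -> (inord k : 'I_n.+2) != ord_max.
Proof. by move=> lk; rewrite -val_eqE /= inordK; lia. Qed.

(* The shift of both coordinates and the transposition of the first one
   generate the transitive group [S_n * C_p]. *)
Lemma grid_transitive n p (P : 'I_n.+2 -> 'I_p.+2 -> Prop) :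
  (forall x y, P x y -> P (ordS x) (ordS y)) ->
  (forall y, P (inord 0) y -> P (inord 1) y) ->
  forall x y x' y', P x y -> P x' y' .
Proof.
move=> PD PA.
have PDV x y : P (ordS x) (ordS y) -> P x y.
  have fI : injective (fun z : 'I_n.+2 * 'I_p.+2 => (ordS z.1, ordS z.2)).
    by move=> [a b] [a' b'] /pair_equal_spec[/ordS_inj /= -> /ordS_inj /= ->].
  by move=> h; apply: (@inj_closed _ _ (fun z => P z.1 z.2) fI _ (x, y)) => // z; apply: PD.
(* Shifting the first coordinate alone: [PA] does it at 0, and conjugating by a power of the
   diagonal shift does it everywhere else. *)
have PE x y : P x y -> P (ordS x) y.
  rewrite -(iter_ordS_from0 x); elim: (val x) y => [|k IH] y.
    by move=> /PA; rewrite /= ordS_inord.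
  by rewrite -(ord_predK y) iterS => /PDV/IH/PD; rewrite -iterS.
have PX y x x' : P x y -> P x' y.
  have [k <-] := iter_ordS_hits x x'; elim: k => //= k IH /IH; exact: PE.
move=> x y x' y'; have [k <-] := iter_ordS_hits y y' => Pxy.
by apply: (PX _ x); elim: k => //= k /PD; apply: PX.
Qed.

(** * Two games on token positions, for reachability and for distinguishability *)

Section Games.
Variables n p : nat.
Implicit Types (x : 'I_n.+3) (y : 'I_p.+3).

(* The boolean tells the state 1 of the first automaton from the state 0. *)
(* Only the position, not a whole set of tokens, can be moved freely: for [n] odd
   and [p] even no sequence of moves flips the boolean and fixes every token. *)
Lemma two_state_game (G : bool -> 'I_n.+3 -> 'I_p.+3 -> Prop) :
  (forall q x y, G q x y -> G (~~ q) (ordS x) (ordS y)) ->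
  (forall x y, G false x y -> G true (swap01 x) y) ->
  G false (inord 1) (inord 0) -> forall q x y, G q x y.
Proof.
move=> GD GA G0.
have GDV q x y : G (~~ q) (ordS x) (ordS y) -> G q x y.
  have fI : injective (fun z : bool * ('I_n.+3 * 'I_p.+3) =>
                         (~~ z.1, (ordS z.2.1, ordS z.2.2))).
    move=> [a [b c]] [a' [b' c']] /pair_equal_spec[/negb_inj /= ->].
    by case/pair_equal_spec=> /ordS_inj /= -> /ordS_inj /= ->.
  move=> h; apply: (@inj_closed _ _ (fun z => G z.1 z.2.1 z.2.2) fI _ (q, (x, y))) => // z.
  exact: GD.
(* [E] makes the boolean free. Where [x > 1] the transposition fixes the token but turns [false]
   into [true], so [G false] suffices there. *)
pose E x y := forall q, G q x y.
have ED x y : E x y -> E (ordS x) (ordS y).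
  by move=> Exy q; rewrite -(negbK q); apply: GD.
have EDV x y : E (ordS x) (ordS y) -> E x y by move=> Exy q; apply: GDV.
have EF x y : 1 < x -> G false x y -> E x y.
  by move=> gt1 G1 [] //; rewrite -(swap01_fix gt1); apply: GA.
(* From [true] one shift gives [false] at position 3, if there is such a state. With exactly three
   states, three shifts return to position 2 and flip the boolean an odd number of times. *)
have C2 q y : G q (inord 2) y -> E (inord 2) y.
  case: q => [G1|]; last by apply: EF => //; rewrite inordK.
  have [n0|n0] := eqVneq n 0.
    have S3 : ordS (ordS (ordS (inord 2))) = inord 2 :> 'I_n.+3.
      by apply: val_inj; rewrite /= inordK // n0.
    have := GD _ _ _ (GD _ _ _ (GD _ _ _ G1)); rewrite /= S3 => G2.
    by apply/(EDV)/(EDV)/(EDV); rewrite S3; apply: EF; rewrite ?inordK.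
  have := GD _ _ _ G1; rewrite /= ordS_inord; last by lia.
  move=> G3; apply: EDV; rewrite ordS_inord; last by lia.
  by apply: EF G3; rewrite inordK //; lia.
have C x q y : G q x y -> E x y.
  have [k] := iter_ordS_hits x (inord 2).
  elim: k q x y => /= [|k IH] q x y; first by move=> ->; apply: C2.
  by rewrite -iterS iterSr => /IH Ek /GD/Ek/EDV.
move=> q x y; suff : E x y by apply.
apply: (grid_transitive ED) (C _ _ _ G0) => t E0.
by have := GA _ _ (E0 false); rewrite tpermL => /C.

Qed.

Variable m : nat.
Implicit Type q : 'I_m.+3.

(* Entering the final state of the first automaton adds the states 0 of the other
   two; a position is safe when this addition cannot touch it. *)
Definition safe q x y := (q == ord_max) ==> ((x != inord 0) && (y != inord 0)).

(** Safety is tested after each letter, when the insertion takes place, and not at the starting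
    position. *)
Inductive win q x y : Prop :=
| win_end of x = ord_max & y = ord_max
| win_a of safe (ordS q) (swap01 x) y & win (ordS q) (swap01 x) y
| win_b of safe (swap01 q) (ordS x) (ordS y) & win (swap01 q) (ordS x) (ordS y).

Lemma safe_nonfinal q x y : q != ord_max -> safe q x y.
Proof. by rewrite /safe => /negPf->. Qed.

(** [Q x y] says that the token wins from every nonfinal [q]. The failure of [Q] is preserved by the
    generators in [grid_transitive], so a single failure would spread to the accepting position,
    which wins at once. The letter [b] keeps [q] nonfinal and is free in both directions; only [a]
    played from [q = m - 2] needs care. *)
Lemma win_nonfinal q x y : q != ord_max -> win q x y.
Proof.
pose P (z : 'I_m.+3 * ('I_n.+3 * 'I_p.+3)) := z.1 != ord_max -> win z.1 z.2.1 z.2.2.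
pose f (z : 'I_m.+3 * ('I_n.+3 * 'I_p.+3)) : 'I_m.+3 * ('I_n.+3 * 'I_p.+3) :=
  (swap01 z.1, (ordS z.2.1, ordS z.2.2)).
have PV z : P (f z) -> P z.
  move=> Pf zN; have fN : (f z).1 != ord_max by rewrite swap01_max.
  by apply: win_b (Pf fN); apply: safe_nonfinal.
have PD z : P z -> P (f z).
  have fI : injective f.
    move=> [a [b c]] [a' [b' c']] /pair_equal_spec[/perm_inj /= ->].
    by case/pair_equal_spec=> /ordS_inj /= -> /ordS_inj /= ->.
  move=> Pz; apply: contrapT; move: z Pz.
  suff H z : ~ P (f z) -> ~ P z by move=> z Pz nPf; case: (H _ nPf).
  by apply: (@inj_closed _ _ (fun z => ~ P z) fI) => {}z nPz /PV.
pose Q x y := forall q, q != ord_max -> win q x y.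
have QD x0 y0 : Q x0 y0 -> Q (ordS x0) (ordS y0).
  move=> Qxy r rN; rewrite -(tpermK (inord 0) (inord 1) r).
  apply: (PD (swap01 r, (x0, y0))) => [_|]; last by rewrite /= tpermK.
  by apply: Qxy; rewrite swap01_max.
have QDV x0 y0 : Q (ordS x0) (ordS y0) -> Q x0 y0.
  move=> Qxy r; apply: (PV (r, (x0, y0))) => /=; exact: Qxy.
have S2 : ordS (ordS (inord 0)) = inord 2 :> 'I_n.+3 by rewrite !ordS_inord.
have QA y0 : Q (inord 1) y0 -> Q (inord 0) y0.
  move=> Q1 r rN; have [r1|r1] := eqVneq (ordS r) ord_max; last first.
    by apply: win_a; rewrite ?tpermL; [apply: safe_nonfinal | apply: Q1].
  have S0 : ordS (ordS r) = inord 0 by rewrite r1 ordS_max.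
  (* From [q = m - 2], either [aba] or [bbaa] passes [m - 1] safely. *)
  have [y2|y2] := eqVneq (ordS (ordS y0)) (inord 0).
    have y0N : y0 != inord 0.
      by apply: contra_eqN y2 => /eqP->; rewrite !ordS_inord // inord_eq.
    have y1N : ordS y0 != inord 0.
      by apply: contra_eqN y2 => /eqP->; rewrite !ordS_inord // inord_eq.
    apply: win_a; rewrite tpermL r1; first by rewrite /safe y0N inord_eq ?implybT.
    have mfix : swap01 (ord_max : 'I_m.+3) = ord_max by apply: swap01_fix.
    apply: win_b; rewrite mfix ordS_inord //; first by rewrite /safe y1N inord_eq ?implybT.
    have fix2 : swap01 (inord 2 : 'I_n.+3) = inord 2 by apply: swap01_fix; rewrite inordK.
    apply: win_a; rewrite ordS_max fix2; first by rewrite safe_nonfinal ?max_neq_inord.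
    by rewrite -ordS_inord //; apply: QD; rewrite // max_neq_inord.
  have fix2 : swap01 (inord 2 : 'I_n.+3) = inord 2 by apply: swap01_fix; rewrite inordK.
  (* The position [(0, y0)] with [q = 0] wins by playing [a]. Two letters [b] bring [q] back to 0
     and the token to [(2, y0 + 2)], and [PD] carries the win along. *)
  have W0 : win (inord 0 : 'I_m.+3) (inord 2) (ordS (ordS y0)).
    have P0 : P (inord 0, (inord 0, y0)).
      move=> _; apply: win_a; rewrite /= tpermL ordS_inord //.
        by rewrite safe_nonfinal ?max_neq_inord.
      by apply: Q1; rewrite max_neq_inord.
    have := PD _ (PD _ P0); rewrite /f /P /= tpermL tpermR S2; apply.
    by rewrite max_neq_inord.
  apply: (PV (_, (_, _))) => //; apply: PV => _; rewrite /= tpermK S2.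
  apply: win_a; rewrite r1 fix2; first by rewrite /safe y2 inord_eq ?implybT.
  apply: win_a; rewrite ordS_max fix2 // safe_nonfinal ?max_neq_inord //.
move=> qN; suff : Q x y by apply.
apply: contrapT => nQ; suff : ~ Q ord_max ord_max by apply; move=> r _; apply: win_end.
apply: (@grid_transitive _ _ (fun x0 y0 => ~ Q x0 y0)) nQ => [x0 y0|y0] nQ0.
  by move=> /QDV.
by move=> /QA.
Qed.
End Games.

(** * The automata [X_dfa] and their state complexity *)

Definition contract10 n (i : 'I_n.+1) : 'I_n.+1 := if i == inord 1 then inord 0 else i.

(** Powers of the cycle letter alone reach all states and separate any two of them. *)
Lemma X_sc (A : finType) n (a : A) s2 s3 :
  is_sc (dfa_lang (X_dfa n.+1 (Some a) s2 s3)) n.+1.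
Proof.
set M := X_dfa _ _ _ _.
have runE k (q : M) : run q (nseq k a) = iter k (@ordS n.+1) q.
  by elim: k q => //= k IH q; rewrite IH /X_step eqxx -iterSr.
have cM : #|[set: M]| = n.+1 by rewrite cardsT card_ord.
rewrite -[X in is_sc _ X]cM.
apply: (@sc_invariant_eq _ M setT) => [|q x|q|q r] //; rewrite ?inE // => _.
  by have [k <-] := iter_ordS_hits (dfa_init M) q; exists (nseq k a).
move=> _ qr; have [k qk] := iter_ordS_hits q ord_max.
have rk : iter k (@ordS n.+1) r != ord_max.
  rewrite -qk; apply: contra_neq qr => {qk} e; apply/esym; move: e.
  by elim: k => //= j IH /ordS_inj.
by exists (nseq k a); rewrite !runE /= qk !inE eqxx (negPf rk).
Qed.

(** * The witnesses, treated uniformly: distinguishability first *)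

Definition cat_wit m (K : finType) (kstep : K -> letter -> K) (I F : {set K}) :=
  cat_dfa (X_dfa m.+3 (Some La) (Some Lb) None) kstep I F.

(* [U x y] is [[set (x, y)]] for the intersection and [[set inl x; inr y]] for the
   union; [U] at (0, 0) and at the final states gives [I] and [F]. *)
Section Witness.
Variables (m n p : nat) (K : finType) (kstep : K -> letter -> K).
Variable U : 'I_n.+3 -> 'I_p.+3 -> {set K}.

Let I := U (inord 0) (inord 0).
Let M := cat_wit m kstep I (U ord_max ord_max).
Implicit Types (q : 'I_m.+3) (S : {set K}) (k : K).

Hypothesis Ua : forall x y k, (kstep k La \in U (swap01 x) y) = (k \in U x y).
Hypothesis Ub : forall x y k, (kstep k Lb \in U (ordS x) (ordS y)) = (k \in U x y).

Hypothesis Ka : injective (kstep^~ La).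
Hypothesis Kb : injective (kstep^~ Lb).
Hypothesis I0 : I != set0.

Definition enter_max q S := if q == ord_max then S :|: I else S.

Lemma stepE q S l : @dfa_step _ M (q, S) l =
  let q' := match l with La => ordS q | Lb => swap01 q | Lc => q end in
  (q', enter_max q' (kstep^~ l @: S)).
Proof.
by rewrite /= /cat_step /cat_enter /enter_max /=; case: l; rewrite /X_step /= inE.
Qed.

Lemma run1E q S l : run ((q, S) : M) [:: l] =
  let q' := match l with La => ordS q | Lb => swap01 q | Lc => q end in
  (q', enter_max q' (kstep^~ l @: S)).
Proof. exact: stepE. Qed.

Hypothesis Usafe : forall x y k, x != inord 0 -> y != inord 0 -> k \in I -> k \notin U x y.
Hypothesis collapse : exists2 r, 0 < r
  & forall k, foldl kstep k (flatten (nseq r [:: Lc; Lb])) \notin I.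
(* For the union, a token of one summand missing from [S] must be completed by a
   missing token of the other summand, which the contraction [c] provides. *)
Hypothesis isolate : forall S k, k \notin S -> exists w x y,
  [/\ La \notin w, foldl kstep k w \in U x y
    & forall k', k' \in S -> foldl kstep k' w \notin U x y].

(** Without [a] the first component neither enters nor leaves [m - 1], so the insertion of [I]
    happens either never or at every letter. *)
Lemma run_no_a q S w : La \notin w -> exists q' S',
  [/\ run ((q, S) : M) w = (q', S'), (q' == ord_max) = (q == ord_max),
      q != ord_max -> S' = (fun k => foldl kstep k w) @: S
    & q == ord_max -> 0 < size w -> I \subset S'].
Proof.
elim: w q S => [|l w IH] q S lw.
  by exists q, S; split=> // _; rewrite imset_id.
move: lw; rewrite inE negb_or => /andP[lN wN].
set q1 := match l with La => ordS q | Lb => swap01 q | Lc => q end.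
have q1E : (q1 == ord_max) = (q == ord_max).
  by rewrite {}/q1; case: l lN => // _; rewrite swap01_max.
have [q' [S' [e qE nS iS]]] := IH q1 (enter_max q1 (kstep^~ l @: S)) wN.
exists q', S'; split; first by rewrite -e -[LHS]/(run (@dfa_step _ M (q, S) l) w) stepE.
- by rewrite qE.
- move=> qN; rewrite nS ?q1E // /enter_max q1E (negPf qN) -imset_comp.
  by apply: eq_imset.
move=> qm _; case: w {IH wN} e nS iS => [|l' w] e nS iS; last by apply: iS; rewrite ?q1E.
by case: e => _ <-; rewrite /enter_max q1E qm subsetUr.
Qed.

(** The winning play is the distinguishing word. Insertions on the side of [s] cannot remove the
    followed token; on the other side, safety and [Usafe] keep [I] off the followed [U x y]. *)
Lemma win_distinguish q x y (s : M) S k : win q x y ->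
  k \in U x y -> k \in s.2 -> (forall k', k' \in S -> k' \notin U x y) ->
  distinguishable s ((q, S) : M).
Proof.
move=> W; elim: W s S k => {q x y}.
- move=> q x y -> -> s S k kU ks SU; exists [::]; rewrite /= !inE /=.
  have -> : s.2 :&: U ord_max ord_max != set0 by apply/set0Pn; exists k; rewrite inE ks.
  have -> // : S :&: U ord_max ord_max = set0; last by rewrite eqxx.
  by apply/setP => k'; rewrite !inE; apply/negP => /andP[/SU/negP].
- move=> q x y sf _ IH s S k kU ks SU; apply: (@distinguishable_run _ _ _ _ [:: La]).
  rewrite run1E.
  apply: (IH _ _ (kstep k La)); rewrite ?Ua //; first exact: (@mem_run_cat _ _ _ _ _ s [:: La]).
  move=> k'; rewrite /enter_max; have old : k' \in kstep^~ La @: S -> k' \notin U (swap01 x) y.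
    by case/imsetP=> k0 /SU; rewrite -Ua => kN ->.
  case: ifP => [qm|_ /old//]; rewrite inE => /orP[/old//|].
  by move: sf; rewrite /safe qm => /andP[/Usafe h] /h; apply.
move=> q x y sf _ IH s S k kU ks SU; apply: (@distinguishable_run _ _ _ _ [:: Lb]).
rewrite run1E.
apply: (IH _ _ (kstep k Lb)); rewrite ?Ub //; first exact: (@mem_run_cat _ _ _ _ _ s [:: Lb]).
move=> k'; rewrite /enter_max; have old : k' \in kstep^~ Lb @: S -> k' \notin U (ordS x) (ordS y).
  by case/imsetP=> k0 /SU; rewrite -Ub => kN ->.
case: ifP => [qm|_ /old//]; rewrite inE => /orP[/old//|].
by move: sf; rewrite /safe qm => /andP[/Usafe h] /h; apply.
Qed.

Lemma mem_distinguish_nonfinal (s : M) q S k : q != ord_max ->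
  k \in s.2 -> k \notin S -> distinguishable s ((q, S) : M).
Proof.
move=> qN ks /isolate[w [x [y [wN kU SU]]]]; apply: (@distinguishable_run _ _ _ _ w).
have [q' [S' [e qE SE _]]] := run_no_a q S wN.
rewrite e; apply: (@win_distinguish _ x y _ _ (foldl kstep k w)) => //.
- by apply: win_nonfinal; rewrite qE.
- exact: mem_run_cat.
by move=> k'; rewrite SE // => /imsetP[k0 /SU h ->].
Qed.

Lemma mem_distinguish (s : M) q S k :
  k \in s.2 -> k \notin S -> distinguishable s ((q, S) : M).
Proof.
move=> ks kS; have [qm|] := eqVneq q ord_max; last first.
  by move/mem_distinguish_nonfinal; apply; eauto.
(* One letter [a] takes [q] from [m - 1] to 0 without inserting [I], and is injective on tokens, so
   the difference survives. *)
apply: (@distinguishable_run _ _ _ _ [:: La]).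
rewrite run1E.
have qN : ordS q != ord_max by rewrite qm ordS_max max_neq_inord.
apply: (@mem_distinguish_nonfinal _ _ _ (kstep k La)) => //.
  exact: (@mem_run_cat _ _ _ _ _ s [:: La]).
by rewrite /enter_max (negPf qN) mem_imset.
Qed.

Lemma distinguish (s t : M) : s != t -> distinguishable s t.
Proof.
case: s t => [q S] [q' S'] st.
have [qq|qq] := eqVneq q q'; last first.
  have [j qj] := iter_ordS_hits q ord_max.
  have runa i q0 S0 : exists S1, run ((q0, S0) : M) (nseq i La) = (iter i (@ordS _) q0, S1).
    elim: i q0 S0 => [|i IH] q0 S0; first by exists S0.
    have [S1 e] := IH (ordS q0) (enter_max (ordS q0) (kstep^~ La @: S0)).
    by exists S1; rewrite iterSr -e -[LHS]/(run (@dfa_step _ M (q0, S0) La) (nseq i La)) stepE.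
  apply: (@distinguishable_run _ _ _ _ (nseq j La)).
  have [S1 ->] := runa j q S; have [S1' ->] := runa j q' S'; rewrite qj.
  have q'N : iter j (@ordS _) q' != ord_max.
    rewrite -qj; apply: contra_neq qq => {qj}.
    by elim: j => // j IH /ordS_inj.
  have [r r0 coll] := collapse; pose w := flatten (nseq r [:: Lc; Lb]).
  have wN : La \notin w by rewrite /w; elim: (r) => //= i; rewrite !inE.
  apply: (@distinguishable_run _ _ _ _ w).
  have [q2 [S2 [e2 _ _ IS2]]] := run_no_a ord_max S1 wN.
  have [q2' [S2' [e2' _ SE2' _]]] := run_no_a (iter j (@ordS _) q') S1' wN.
  rewrite e2 e2'.
  have [k kI] := set0Pn _ I0; apply: (@mem_distinguish _ _ _ k) => /=.
    by apply: (subsetP (IS2 _ _)) => //; rewrite /w; case: (r) r0.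
  rewrite SE2' //; apply/imsetP => -[k0 _ kE]; have := coll k0.
  by rewrite -/w -kE kI.
have : S != S' by apply: contraNneq st => ->; rewrite qq.
rewrite eqEsubset negb_and => /orP[]/subsetPn[k kS kS'].
  exact: mem_distinguish kS'.
by apply: distinguishable_sym; apply: mem_distinguish kS'.
Qed.

(** * Reachability for the witnesses *)

Variable B : {set {set K}}.
Hypothesis B0 : set0 \in B.
Hypothesis Ba : forall S, S \in B -> kstep^~ La @^-1: S \in B.
Hypothesis Bb : forall S, S \in B -> kstep^~ Lb @^-1: S \in B.
Hypothesis BU : forall S, S \in B -> S != set0 -> exists x y, U x y \subset S.
Hypothesis Bsplit : forall S, S \in B -> I \subset S ->
  exists S', [/\ S' \in B, #|S'| < #|S| & S = S' :|: I].

Let reach q S := @reachable _ M (q, S).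

Lemma reach_a q S : reach q (kstep^~ La @^-1: S) -> reach (ordS q) (enter_max (ordS q) S).
Proof.
move=> /(@reachable_step _ M (q, _) La).
by rewrite stepE /= (imset_preimset_inj S Ka).
Qed.

Lemma reach_b q S : reach q (kstep^~ Lb @^-1: S) ->
  reach (swap01 q) (enter_max (swap01 q) S).
Proof.
move=> /(@reachable_step _ M (q, _) Lb).
by rewrite stepE /= (imset_preimset_inj S Kb).
Qed.

Lemma reach_all S : S \in B -> forall q, (q == ord_max) ==> (I \subset S) -> reach q S.
Proof.
have [N] := ubnP #|S|; elim: N S => // N IH S /ltnSE leN SB.
(* Reachability passes from [q = 0] to all nonfinal [q] by powers of [a] that stop before [m - 1],
   hence without insertion. *)
have spread (P : {set K} -> Prop) : (forall S, P S -> P (kstep^~ La @^-1: S)) ->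
    (forall S, P S -> reach (inord 0) S) ->
    forall q S, q != ord_max -> P S -> reach q S.
  move=> Pa P0 q S0 qN; rewrite -(iter_ordS_from0 q); move: qN.
  rewrite -val_eqE /=; have := ltn_ord q; elim: (nat_of_ord q) S0 => [|k IHk] S0 lk kN PS0.
    exact: P0.
  have kE : val (iter k (@ordS m.+3) (inord 0)) = k.
    by rewrite val_iter_ordS inordK //; lia.
  have := reach_a (IHk _ _ _ (Pa _ PS0)); rewrite -iterS /enter_max.
  have kN' : iter k.+1 (@ordS m.+3) (inord 0) != ord_max.
    by rewrite -val_eqE val_iter_ordS inordK //=; lia.
  by rewrite (negPf kN'); apply; lia.
(* The smaller set given by [Bsplit], pulled back by [a], is reachable at [m - 2] by induction;
   entering [m - 1] then adds [I]. *)
have final S0 : S0 \in B -> #|S0| <= N -> I \subset S0 -> reach ord_max S0.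
  move=> S0B S0N IS0; have [S1 [S1B lt1 ->]] := Bsplit S0B IS0.
  have qN : ord_pred ord_max != ord_max :> 'I_m.+3.
    by rewrite -(inj_eq (@ordS_inj _)) ord_predK ordS_max eq_sym max_neq_inord.
  have := @reach_a (ord_pred ord_max) S1; rewrite ord_predK /enter_max eqxx; apply.
  apply: IH; rewrite ?Ba // ?(negPf qN) // card_preimset_inj //; lia.
have [->|S0] := eqVneq S set0.
  move=> q qI; have qN : q != ord_max.
    by apply: contraTneq qI => ->; rewrite eqxx subset0.
  apply: (spread (fun S => S = set0)) => // [_ ->|_ ->]; first by rewrite preimset0.
  exists [::]; rewrite /= /cat_enter inE; congr (_, _); first by apply: val_inj; rewrite /= inordK.
pose sizeN S1 := [/\ S1 \in B, #|S1| <= N & S1 != set0].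
have sizeNa S1 : sizeN S1 -> sizeN (kstep^~ La @^-1: S1).
  by case=> S1B le1 S1N; split; rewrite ?Ba -?card_gt0 ?card_preimset_inj // card_gt0.
have start S1 : sizeN S1 -> reach (inord 0) S1.
  case=> S1B le1 S1N.
  (* The position is that of one [U x y] contained in the set; the rest of the set is arbitrary and
     is pulled back along each move. The game starts with [a] played from [m - 1], which takes [I]
     to [U 1 0]. *)
  pose G (r : bool) x y := forall S2, S2 \in B -> #|S2| <= N -> U x y \subset S2 ->
     reach (inord r) S2.
  suff Gall : forall r x y, G r x y.
    by have [x [y Uxy]] := BU S1B S1N; apply: (Gall false x y).
  apply: two_state_game => [r x y Gr S2 S2B le2 U2|x y Gr S2 S2B le2 U2|S2 S2B le2 U2].
  - have := @reach_b (inord r) S2; have -> : swap01 (inord r) = inord (~~ r) :> 'I_m.+3.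
      by case: r {Gr}; rewrite ?tpermL ?tpermR.
    rewrite /enter_max (negPf (max_neq_inord _)); last by case: (r).
    apply; apply: Gr; rewrite ?Bb ?card_preimset_inj //.
    by apply/subsetP=> k kU; rewrite inE; apply: (subsetP U2); rewrite Ub.
  - have := @reach_a (inord 0) S2; rewrite ordS_inord // /enter_max (negPf (max_neq_inord _)) //.
    apply; apply: Gr; rewrite ?Ba ?card_preimset_inj //.
    by apply/subsetP=> k kU; rewrite inE; apply: (subsetP U2); rewrite Ua.
  have := @reach_a ord_max S2; rewrite ordS_max /enter_max (negPf (max_neq_inord _)) //.
  apply; apply: final; rewrite ?Ba ?card_preimset_inj //.
  apply/subsetP=> k kU; rewrite inE; apply: (subsetP U2).
  by rewrite -(tpermL (inord 0) (inord 1)) Ua.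
move=> q; have [-> /= IS|qN _] := eqVneq q ord_max; first exact: final.
exact: (spread sizeN).
Qed.

Hypothesis Bstep : forall S l, S \in B -> kstep^~ l @: S \in B.
Hypothesis BI : forall S, S \in B -> S :|: I \in B.

Lemma wit_sc : is_sc (dfa_lang M) (m.+2 * #|B| + #|[set S in B | I \subset S]|).
Proof.
have := card_cat_inv (X_dfa m.+3 (Some La) (Some Lb) None) kstep I (U ord_max ord_max) B.
rewrite [#|dfa_final _|]cards1 card_ord mul1n subn1 => <-.
apply: sc_invariant_eq.
- exact: cat_init_inv.
- by move=> s l; apply: cat_step_inv.
- by move=> [q S]; rewrite inE /= inE => /andP[SB]; apply: reach_all.
by move=> s t _ _; apply: distinguish.
Qed.
End Witness.

(** Without final states the language is empty, and one state suffices to recognize it. *)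
Lemma minimal_final_neq0 (A : finType) (L : language A) (M : dfa A) :
  minimal_dfa L M -> 1 < #|M| -> dfa_final M != set0.
Proof.
case=> LE minM M1; apply: contraL M1 => /eqP F0; rewrite -leqNgt.
rewrite -card_unit; apply: (minM (@Dfa A unit tt set0 (fun _ _ => tt))).
by rewrite -LE; apply/seteqP; split=> w; rewrite /dfa_lang /= ?F0 !inE.
Qed.

Lemma card_all_sets (T : finType) : #|[set: {set T}]| = 2 ^ #|T|.
Proof. by rewrite -powersetT card_powerset cardsT. Qed.

Lemma foldl_nseq_flatten (T A : Type) (f : T -> A -> T) w r k :
  foldl f k (flatten (nseq r w)) = iter r (fun k => foldl f k w) k.
Proof. by elim: r k => //= r IH k; rewrite foldl_cat IH -iterSr. Qed.

(** * The product and the disjoint union of two automata *)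

Section Product.
Variables (A : finType) (M2 M3 : dfa A).

Definition cap_step (k : M2 * M3) x := (dfa_step k.1 x, dfa_step k.2 x).

Lemma foldl_cap_step k w : foldl cap_step k w = (run k.1 w, run k.2 w).
Proof. by elim: w k => [|x w IH] [] //= a b; rewrite IH. Qed.

Definition cap_init : {set M2 * M3} := [set (dfa_init M2, dfa_init M3)].

Definition cap_final := setX (dfa_final M2) (dfa_final M3).

Lemma cap_lang v : (dfa_lang M2 `&` dfa_lang M3)%classic v <->
  exists2 i, i \in cap_init & foldl cap_step i v \in cap_final.
Proof.
split=> [[v2 v3]|[i]].
  by exists (dfa_init M2, dfa_init M3); rewrite ?set11 // foldl_cap_step inE; apply/andP.
by rewrite inE => /eqP->; rewrite foldl_cap_step inE => /andP[].
Qed.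

Definition cup_step (k : M2 + M3) x : M2 + M3 :=
  match k with inl a => inl (dfa_step a x) | inr b => inr (dfa_step b x) end.

Lemma foldl_cup_inl a w : foldl cup_step (inl a) w = inl (run a w).
Proof. by elim: w a => //= x w IH a; rewrite IH. Qed.

Lemma foldl_cup_inr b w : foldl cup_step (inr b) w = inr (run b w).
Proof. by elim: w b => //= x w IH b; rewrite IH. Qed.

Definition cup_init : {set M2 + M3} := [set inl (dfa_init M2); inr (dfa_init M3)].

Definition cup_final : {set M2 + M3} :=
  [set k | match k with inl a => a \in dfa_final M2 | inr b => b \in dfa_final M3 end].

Lemma cup_lang v : (dfa_lang M2 `|` dfa_lang M3)%classic v <->
  exists2 i, i \in cup_init & foldl cup_step i v \in cup_final.
Proof.
split=> [[v2|v3]|[i]].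
- by exists (inl (dfa_init M2)); rewrite ?set21 // foldl_cup_inl inE.
- by exists (inr (dfa_init M3)); rewrite ?set22 // foldl_cup_inr inE.
rewrite !inE => /orP[]/eqP->; rewrite ?foldl_cup_inl ?foldl_cup_inr => h.
  by left.
by right.
Qed.

Definition has_inl (S : {set M2 + M3}) := [exists a, inl a \in S].
Definition has_inr (S : {set M2 + M3}) := [exists b, inr b \in S].

Definition cup_sets := [set S : {set M2 + M3} | has_inl S == has_inr S].

Lemma cup_sets0 : set0 \in cup_sets.
Proof.
rewrite inE /has_inl /has_inr.
by apply/eqP; apply/existsP/existsP => -[a]; rewrite inE.
Qed.

Lemma cup_sets_step (S : {set M2 + M3}) x :
  (cup_step^~ x @: S \in cup_sets) = (S \in cup_sets).
Proof.
rewrite !inE; congr (_ == _); apply/existsP/existsP => -[a].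
- by case/imsetP=> -[b bS|//] _; exists b.
- by move=> aS; exists (dfa_step a x); apply/imsetP; exists (inl a).
- by case/imsetP=> -[//|b bS] _; exists b.
by move=> aS; exists (dfa_step a x); apply/imsetP; exists (inr a).
Qed.

Lemma cup_sets_both (S : {set M2 + M3}) a b : inl a \in S -> inr b \in S -> S \in cup_sets.
Proof.
move=> aS bS; rewrite inE; have -> : has_inl S by apply/existsP; exists a.
by have -> : has_inr S by apply/existsP; exists b.
Qed.

Lemma cup_sets_supset (S : {set M2 + M3}) : cup_init \subset S -> S \in cup_sets.
Proof.
move/subsetP=> IS; apply: (@cup_sets_both _ (dfa_init M2) (dfa_init M3)); apply: IS.
  exact: set21.
exact: set22.
Qed.

(** The sets missing a summand are the subsets of the other one, and the two powersets share only
    the empty set. Inclusion-exclusion removes the sets missing some summand, and the empty set is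
    then put back. *)
Lemma card_cup_sets :
  #|cup_sets| = 2 ^ (#|M2| + #|M3|) - 2 ^ #|M2| - 2 ^ #|M3| + 2.
Proof.
pose Ls : {set M2 + M3} := inl @: setT; pose Rs : {set M2 + M3} := inr @: setT.
have cL : #|Ls| = #|M2| by rewrite card_imset ?cardsT // => ? ? [].
have cR : #|Rs| = #|M3| by rewrite card_imset ?cardsT // => ? ? [].
have inlP (S : {set M2 + M3}) : has_inl S = ~~ (S \subset Rs).
  apply/existsP/subsetPn => [[a aS]|[[a aS _|b bS]]].
  - by exists (inl a) => //; apply/imsetP => -[].
  - by exists a.
  by rewrite imset_f.
have inrP (S : {set M2 + M3}) : has_inr S = ~~ (S \subset Ls).
  apply/existsP/subsetPn => [[a aS]|[[b bS|a aS _]]].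
  - by exists (inr a) => //; apply/imsetP => -[].
  - by rewrite imset_f.
  by exists a.
have -> : cup_sets = ~: (powerset Ls :|: powerset Rs) :|: (powerset Ls :&: powerset Rs).
  by apply/setP => S; rewrite !inE inlP inrP; case: (S \subset Ls); case: (S \subset Rs).
have LR : powerset Ls :&: powerset Rs = [set set0].
  apply/setP => S; rewrite !inE; apply/andP/eqP => [[/subsetP SL /subsetP SR]|->];
    last by rewrite !sub0set.
  apply/setP=> -[a|b]; rewrite inE; apply/negP.
    by move/SR/imsetP=> -[].
  by move/SL/imsetP=> -[].
have D : ~: (powerset Ls :|: powerset Rs) :&: (powerset Ls :&: powerset Rs) = set0.
  by apply/setP => S; rewrite !inE; case: (S \subset Ls); case: (S \subset Rs).
rewrite cardsU D cards0 subn0 LR cards1.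
have := cardsC (powerset Ls :|: powerset Rs); rewrite cardsU LR cards1 -cardsT card_all_sets.
rewrite !card_powerset cL cR card_sum.
have pow_gt1 (M : dfa A) : 1 < 2 ^ #|M|.
  have : 0 < #|M| by apply/card_gt0P; exists (dfa_init M).
  by case: #|M| => // j _; rewrite expnS; have := expn_gt0 2 j; lia.
have := pow_gt1 M3; have := pow_gt1 M2; rewrite expnD.
move: (2 ^ #|M2|) (2 ^ #|M3|) (#|~: _|) => a b c a1 b1 abc.
(* This keeps the truncated subtractions exact. *)
have : a + b <= a * b by nia.
by lia.
Qed.

Lemma card_cap_supersets :
  #|[set S in [set: {set M2 * M3}] | cap_init \subset S]| = 2 ^ (#|M2| * #|M3| - 1).
Proof.
have := card_supersets cap_init; rewrite cards1 card_prod => <-.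
by apply: eq_card => S; rewrite !inE.
Qed.

Lemma card_cup_supersets :
  #|[set S in cup_sets | cup_init \subset S]| = 2 ^ (#|M2| + #|M3| - 2).
Proof.
have := card_supersets cup_init; rewrite cards2 card_sum => <-; apply: eq_card => S.
by rewrite !inE andb_idl // => /cup_sets_supset; rewrite inE.
Qed.

End Product.

(** * Upper bounds *)

Section UpperBound.
Variables (A : finType) (L1 L2 L3 : language A) (m n p : nat).
Hypotheses (m1 : 1 < m) (sc1 : is_sc L1 m) (sc2 : is_sc L2 n) (sc3 : is_sc L3 p).


Lemma cat_cap_sc_le : exists2 k, is_sc (cat_cap L1 L2 L3) k
  & k <= (m - 1) * 2 ^ (n * p) + 2 ^ (n * p - 1).
Proof.
have [M1 min1 c1] := sc1; have [M2 [<- _] <-] := sc2; have [M3 [<- _] <-] := sc3.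
have F1 : dfa_final M1 != set0 by apply: minimal_final_neq0 min1 _; rewrite c1.
case: min1 => <- _; rewrite -c1 /cat_cap -(cat_dfa_lang M1 (@cap_lang _ M2 M3)).
by rewrite -card_cap_supersets -card_prod -card_all_sets; apply: cat_sc_le => // *; rewrite inE.
Qed.

Lemma cat_cup_sc_le : exists2 k, is_sc (cat_cup L1 L2 L3) k
  & k <= (m - 1) * (2 ^ (n + p) - 2 ^ n - 2 ^ p + 2) + 2 ^ (n + p - 2).
Proof.
have [M1 min1 c1] := sc1; have [M2 [<- _] <-] := sc2; have [M3 [<- _] <-] := sc3.
have F1 : dfa_final M1 != set0 by apply: minimal_final_neq0 min1 _; rewrite c1.
case: min1 => <- _; rewrite -c1 /cat_cup -(cat_dfa_lang M1 (@cup_lang _ M2 M3)).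
rewrite -card_cup_supersets -card_cup_sets; apply: cat_sc_le => //.
- exact: cup_sets0.
- by move=> S x; rewrite cup_sets_step.
by move=> S _; apply: cup_sets_supset; apply: subsetUr.
Qed.
End UpperBound.

(** * The witnesses for intersection and for union *)

Section Instances.
Variables m n p : nat.

Let M2 : dfa letter := X_dfa n.+3 (Some Lb) (Some La) (Some Lc).
Let M3 : dfa letter := X_dfa p.+3 (Some Lb) None (Some Lc).

(** The word [cb] sends 0 and 1 to 1, the last state to 0, and any other state to its successor.
    After [j] steps the state is therefore at most 1 or at least [j]; the latter is impossible for
    [j >= k + 3], and one more step gives 1. *)
Lemma run_flatten_collapse (M : dfa letter) k (f : M -> 'I_k.+3) r q :
  (forall q, f (dfa_step (dfa_step q Lc) Lb) = ordS (contract10 (f q))) ->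
  k + 4 <= r -> f (run q (flatten (nseq r [:: Lc; Lb]))) = inord 1.
Proof.
move=> fE kr; rewrite /run foldl_nseq_flatten /=.
have {fE} -> : f (iter r (fun q => dfa_step (dfa_step q Lc) Lb) q)
   = iter r (fun x => ordS (contract10 x)) (f q).
  by elim: (r) => //= j IH; rewrite fE IH.
move: (f q) => {q} x.
have bnd j : iter j (fun x => ordS (contract10 x)) x <= 1 \/
             j <= iter j (fun x => ordS (contract10 x)) x.
  elim: j => [|j]; [by right | rewrite iterS /contract10].
  move: (iter j _ x) => z; case: eqVneq => [_ _|z1].
    by left; rewrite ordS_inord // inordK.
  have [zm|zm] := eqVneq z ord_max; first by left; rewrite zm ordS_max inordK.
  have z1' : z <> 1 :> nat by move=> e; case/eqP: z1; apply: val_inj; rewrite /= inordK.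
  by rewrite (ordS_neq_max zm); lia.
case: r kr => [|r] kr; first by rewrite addnS in kr.
rewrite iterS.
have : iter r (fun x => ordS (contract10 x)) x <= 1.
  by case: (bnd r) => //; have := ltn_ord (iter r (fun x => ordS (contract10 x)) x); lia.
move: (iter r _ x) => z; rewrite /contract10 => z1.
case: eqVneq => [_|zN1]; first by rewrite ordS_inord.
have -> : z = inord 0; last by rewrite ordS_inord.
have z1' : z <> 1 :> nat by move=> e; case/eqP: zN1; apply: val_inj; rewrite /= inordK.
by apply: val_inj; rewrite /= inordK //; lia.
Qed.

Let r := (n + p) + 4.

Lemma run_collapse2 (x : M2) : run x (flatten (nseq r [:: Lc; Lb])) = inord 1.
Proof. by apply: (@run_flatten_collapse M2 n id) => //; rewrite /r; lia. Qed.

Lemma run_collapse3 (x : M3) : run x (flatten (nseq r [:: Lc; Lb])) = inord 1.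
Proof. by apply: (@run_flatten_collapse M3 p id) => //; rewrite /r; lia. Qed.

Lemma step_a_involutive2 : involutive (fun x : M2 => dfa_step x La).
Proof. exact: tpermK. Qed.

Let Ucap (x : 'I_n.+3) (y : 'I_p.+3) : {set M2 * M3} := [set (x, y)].

Lemma cat_cap_wit_sc : is_sc (cat_cap (witness1 m.+3) (witness2 n.+3) (witness3 p.+3))
  (m.+2 * 2 ^ (n.+3 * p.+3) + 2 ^ (n.+3 * p.+3 - 1)).
Proof.
have i0 k : ord0 = inord 0 :> 'I_k.+1 by apply: val_inj; rewrite /= inordK.
rewrite /cat_cap -(cat_dfa_lang _ (@cap_lang _ M2 M3)).
have -> : cap_init M2 M3 = Ucap (inord 0) (inord 0) by rewrite /cap_init /= !i0.
have -> : cap_final M2 M3 = Ucap ord_max ord_max.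
  by apply/setP=> -[x y]; rewrite /cap_final /= !inE xpair_eqE.
have -> : 2 ^ (n.+3 * p.+3 - 1)
   = #|[set S in [set: {set M2 * M3}] | Ucap (inord 0) (inord 0) \subset S]|.
  rewrite -[n.+3 in LHS]card_ord -[p.+3 in LHS]card_ord -(@card_cap_supersets _ M2 M3).
  by rewrite /cap_init /= !i0.
have -> : 2 ^ (n.+3 * p.+3) = #|[set: {set M2 * M3}]|.
  by rewrite card_all_sets card_prod !card_ord.
have Ka : injective ((@cap_step _ M2 M3)^~ La).
  move=> [a b] [a' b'] /pair_equal_spec[/(inv_inj step_a_involutive2) /= -> e].
  by congr pair; exact: e.
have Kb : injective ((@cap_step _ M2 M3)^~ Lb).
  by move=> [a b] [a' b'] /pair_equal_spec[/ordS_inj /= -> /ordS_inj /= ->].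
apply: wit_sc => //.
- by move=> x y k; rewrite !inE -(inj_eq Ka k).
- by move=> x y k; rewrite !inE -(inj_eq Kb k).
- by apply/set0Pn; exists (inord 0, inord 0); rewrite inE.
- by move=> x y k x0 y0; rewrite !inE => /eqP->; rewrite xpair_eqE eq_sym (negPf x0).
- exists r => [|[a b]]; first by rewrite /r; lia.
  by rewrite foldl_cap_step inE /= run_collapse2 run_collapse3 xpair_eqE inord_eq.
(* Each [U x y] is a single token here, so the empty word isolates it. *)
- move=> S [x y] kS; exists [::], x, y; split; rewrite ?inE //= => k' k'S.
  by rewrite inE; apply: contraNneq kS => <-.
- by rewrite inE.
- by move=> S _; rewrite inE.
- by move=> S _; rewrite inE.
- by move=> S _ /set0Pn[[x y] kS]; exists x, y; rewrite sub1set.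
- move=> S _; rewrite sub1set => kS; exists (S :\ (inord 0, inord 0)); split.
  + by rewrite inE.
  + by rewrite [ltnRHS](cardsD1 (inord 0, inord 0)) kS.
  + by rewrite setUC setD1K.
- by move=> S l _; rewrite inE.
by move=> S _; rewrite inE.
Qed.

Let Ucup (x : 'I_n.+3) (y : 'I_p.+3) : {set M2 + M3} := [set inl x; inr y].

Lemma cat_cup_wit_sc : is_sc (cat_cup (witness1 m.+3) (witness2 n.+3) (witness3 p.+3))
  (m.+2 * (2 ^ (n.+3 + p.+3) - 2 ^ n.+3 - 2 ^ p.+3 + 2) + 2 ^ (n.+3 + p.+3 - 2)).
Proof.
have i0 k : ord0 = inord 0 :> 'I_k.+1 by apply: val_inj; rewrite /= inordK.
rewrite /cat_cup -(cat_dfa_lang _ (@cup_lang _ M2 M3)).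
have IE : cup_init M2 M3 = Ucup (inord 0) (inord 0) by rewrite /cup_init /= !i0.
rewrite IE.
have -> : cup_final M2 M3 = Ucup ord_max ord_max.
  by apply/setP=> -[x|y]; rewrite !inE ?orbF /=.
have -> : 2 ^ (n.+3 + p.+3 - 2)
   = #|[set S in cup_sets M2 M3 | Ucup (inord 0) (inord 0) \subset S]|.
  by rewrite -IE card_cup_supersets !card_ord.
have -> : 2 ^ (n.+3 + p.+3) - 2 ^ n.+3 - 2 ^ p.+3 + 2 = #|cup_sets M2 M3|.
  by rewrite card_cup_sets !card_ord.
have Ka : injective ((@cup_step _ M2 M3)^~ La).
  by move=> [a|b] [a'|b'] //= [] // /(inv_inj step_a_involutive2) ->.
have Kb : injective ((@cup_step _ M2 M3)^~ Lb).
  move=> [a|b] [a'|b'] //= e.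
    by have /ordS_inj -> : ordS (a : 'I_n.+3) = ordS a' by case: e => ?; apply: val_inj.
  by have /ordS_inj -> : ordS (b : 'I_p.+3) = ordS b' by case: e => ?; apply: val_inj.
have pre l S : injective ((@cup_step _ M2 M3)^~ l) -> S \in cup_sets M2 M3 ->
    (@cup_step _ M2 M3)^~ l @^-1: S \in cup_sets M2 M3.
  by move=> lI SB; rewrite -(cup_sets_step _ l) imset_preimset_inj.
have runb j (x : M2) : run x (nseq j Lb) = iter j (@ordS n.+3) x.
  by elim: j x => //= j IH x; rewrite IH -iterSr.
have runb' j (x : M3) : run x (nseq j Lb) = iter j (@ordS p.+3) x.
  by elim: j x => //= j IH x; rewrite IH -iterSr.
apply: wit_sc => //.
- by move=> x y k; rewrite !inE -!(inj_eq Ka k).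
- by move=> x y k; rewrite !inE -!(inj_eq Kb k).
- by apply/set0Pn; exists (inl (inord 0)); rewrite !inE eqxx.
- move=> x y k x0 y0; rewrite !inE => /orP[]/eqP->.
    by rewrite orbF; apply: contra x0 => /eqP[->].
  by rewrite orFb; apply: contra y0 => /eqP[->].
- exists r => [|[a|b]]; first by rewrite /r; lia.
    by rewrite foldl_cup_inl !inE run_collapse2 orbF; apply/eqP => -[] /eqP; rewrite inord_eq.
  by rewrite foldl_cup_inr !inE run_collapse3; apply/eqP => -[] /eqP; rewrite inord_eq.
(* A power of [b] followed by [c] brings the missing token, and no other one of its summand, to
   state 2. Since [c] empties state 1, that state completes the pair in the other summand. *)
- have c1 k (x : 'I_k.+3) : contract10 x != inord 1.
    by rewrite /contract10; case: (eqVneq x) => // _; rewrite inord_eq.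
  have c2 k (x : 'I_k.+3) : contract10 x = inord 2 -> x = inord 2.
    by rewrite /contract10; case: (eqVneq x) => // _ /eqP; rewrite inord_eq.
  have c22 k : contract10 (inord 2) = inord 2 :> 'I_k.+3 by rewrite /contract10 inord_eq.
  have runc (x : M2) j : run x (nseq j Lb ++ [:: Lc]) = contract10 (iter j (@ordS n.+3) x).
    by rewrite /run foldl_cat -[foldl _ x _]/(run x _) runb.
  have runc' (x : M3) j : run x (nseq j Lb ++ [:: Lc]) = contract10 (iter j (@ordS p.+3) x).
    by rewrite /run foldl_cat -[foldl _ x _]/(run x _) runb'.
  have iterI k j : injective (iter j (@ordS k.+3)).
    by elim: j => [|j IH] a b //= /ordS_inj/IH.
  have noa j : La \notin nseq j Lb ++ [:: Lc] by rewrite mem_cat mem_nseq andbF.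
  move=> S [x|y] kS.
    have [j xj] := iter_ordS_hits (x : 'I_n.+3) (inord 2).
    exists (nseq j Lb ++ [:: Lc]), (inord 2), (inord 1); split=> //.
      by rewrite foldl_cup_inl runc xj c22 set21.
    case=> [x'|y'] k'S; rewrite ?foldl_cup_inl ?foldl_cup_inr ?runc ?runc' !inE.
      rewrite orbF; apply: contraNneq kS => -[] /c2; rewrite -xj => /iterI <-.
      exact: k'S.
    by rewrite orFb; apply/eqP => -[] /eqP; apply/negP; exact: c1.
  have [j yj] := iter_ordS_hits (y : 'I_p.+3) (inord 2).
  exists (nseq j Lb ++ [:: Lc]), (inord 1), (inord 2); split=> //.
    by rewrite foldl_cup_inr runc' yj c22 set22.
  case=> [x'|y'] k'S; rewrite ?foldl_cup_inl ?foldl_cup_inr ?runc ?runc' !inE.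
    by rewrite orbF; apply/eqP => -[] /eqP; apply/negP; exact: c1.
  rewrite orFb; apply: contraNneq kS => -[] /c2; rewrite -yj => /iterI <-.
  exact: k'S.
- exact: cup_sets0.
- by move=> S; apply: pre.
- by move=> S; apply: pre.
- move=> S; rewrite inE => /eqP SB /set0Pn[k kS].
  have [x xS] : exists x, inl x \in S.
    case: k kS => [x|y] kS; first by exists x.
    by apply/existsP; rewrite [X in is_true X]SB; apply/existsP; exists y.
  have [y yS] : exists y, inr y \in S.
    by apply/existsP; rewrite -[X in is_true X]SB; apply/existsP; exists x.
  by exists x, y; apply/subsetP => k'; rewrite !inE => /orP[]/eqP->.
- move=> S SB IS.
  have xS : inl (inord 0) \in S by apply: (subsetP IS); exact: set21.
  have yS : inr (inord 0) \in S by apply: (subsetP IS); exact: set22.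
  (* If [S] is [I], the smaller set is empty. Otherwise [S] has a further token, and the initial
     state of the same summand can be removed while both summands are still met. *)
  have [SI|] := eqVneq S (Ucup (inord 0) (inord 0)).
    exists set0; rewrite set0U cup_sets0; split=> //.
    by rewrite cards0 card_gt0; apply/set0Pn; exists (inl (inord 0)).
  rewrite eqEsubset IS andbT => /subsetPn[k kS kI].
  have remove k0 : k0 \in Ucup (inord 0) (inord 0) -> S :\ k0 \in cup_sets M2 M3 ->
      exists S', [/\ S' \in cup_sets M2 M3, #|S'| < #|S|
                   & S = S' :|: Ucup (inord 0) (inord 0)].
    move=> k0I SB'; have k0S := subsetP IS _ k0I.
    exists (S :\ k0); split=> //; first by rewrite [ltnRHS](cardsD1 k0) k0S.
    apply/eqP; rewrite eqEsubset subUset subsetDl IS !andbT.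
    by apply/subsetP => k1 k1S; rewrite inE in_setD1 k1S andbT; case: eqVneq => // ->; rewrite k0I.
  move: kI; case: k kS => [x|y] kS; rewrite !inE ?orbF ?orFb => kI.
    apply: (remove (inl (inord 0))); first exact: set21.
    by apply: (@cup_sets_both _ M2 M3 _ x (inord 0)); rewrite !inE ?kS ?yS ?kI.
  apply: (remove (inr (inord 0))); first exact: set22.
  by apply: (@cup_sets_both _ M2 M3 _ (inord 0) y); rewrite !inE ?kS ?xS ?kI.
- by move=> S l; rewrite cup_sets_step.
by move=> S _; rewrite -IE; apply: cup_sets_supset; apply: subsetUr.
Qed.
End Instances.

Theorem theorem2 (m n p : nat) (hm : 3 <= m) (hn : 3 <= n) (hp : 3 <= p) :
  let vcap := (m - 1) * 2 ^ (n * p) + 2 ^ (n * p - 1) in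
  let vcup := (m - 1) * (2 ^ (n + p) - 2 ^ n - 2 ^ p + 2) + 2 ^ (n + p - 2) in
  [/\ is_sc_op cat_cap m n p vcap,
      is_sc_op cat_cup m n p vcup,
      [/\ is_sc (witness1 m) m, is_sc (witness2 n) n & is_sc (witness3 p) p],
      is_sc (cat_cap (witness1 m) (witness2 n) (witness3 p)) vcap
    & is_sc (cat_cup (witness1 m) (witness2 n) (witness3 p)) vcup].
Proof.
case: m hm => [|[|[|m]]] // _; case: n hn => [|[|[|n]]] // _.
case: p hp => [|[|[|p]]] // _ vcap vcup.
have w1 : is_sc (witness1 m.+3) m.+3 by apply: X_sc.
have w2 : is_sc (witness2 n.+3) n.+3 by apply: X_sc.
have w3 : is_sc (witness3 p.+3) p.+3 by apply: X_sc.
have wcap := cat_cap_wit_sc m n p; have wcup := cat_cup_wit_sc m n p.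
have m2 : m.+3 - 1 = m.+2 by rewrite subn1.
rewrite /vcap /vcup m2; split=> //; split.
- move=> A L1 L2 L3 sc1 sc2 sc3.
  rewrite -[m.+2]m2; exact: cat_cap_sc_le _ sc1 sc2 sc3.
- by exists letter, (witness1 m.+3), (witness2 n.+3), (witness3 p.+3); split.
- move=> A L1 L2 L3 sc1 sc2 sc3.
  rewrite -[m.+2]m2; exact: cat_cup_sc_le _ sc1 sc2 sc3.
by exists letter, (witness1 m.+3), (witness2 n.+3), (witness3 p.+3); split.
Qed.
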